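(* The Lie functor $\mathcal L:\mathcal{SCF}\to\mathcal Lie_{\mathbb Z}$ is exact, i.e. it preserves short exact sequences.
   Context: A strongly central filtration $G_*$ is a group $G=G_1$ with a filtration by subgroups $G_1\supseteq G_2\supseteq\cdots$ such that $[G_i,G_j]\subseteq G_{i+j}$ for all $i,j\geq1$. $\mathcal{SCF}$ is the category of strongly central filtrations, with morphisms the group morphisms $G_1\to H_1$ preserving the filtrations. $\mathcal L(G_* )=\bigoplus_{i\geq1}G_i/G_{i+1}$ is the (graded) Lie ring with bracket induced by $(x,y)\mapsto xyx^{-1}y^{-1}$; $\mathcal Lie_{\mathbb Z}$ is the category of Lie rings. A short exact sequence $G_*\xrightarrow{u}H_*\xrightarrow{v}K_*$ in $\mathcal{SCF}$ consists of a regular epimorphism $v$ and its kernel $u$: concretely, $1\to G_1\to H_1\to K_1\to1$ is exact, $u^{-1}(H_i)=G_i$ and $v(H_i)=K_i$ for all $i\geq1$. *)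

(* Defs.v *)
From HB Require Import structures.
From mathcomp Require Import all_boot ssralg.
From mathcomp Require Import boolp classical_sets.

Set Implicit Arguments.
Unset Strict Implicit.
Unset Printing Implicit Defensive.

Import GRing.Theory.
Local Open Scope classical_set_scope.
Local Open Scope quotient_scope.

Section Commutator.
Variable G : groupType.
Implicit Types (x y z : G) (A B : set G).
Local Open Scope group_scope.

(* MathComp's [~ x, y] is x^-1 * y^-1 * x * y, hence a separate definition. *)
Definition comm x y : G := x * y * x^-1 * y^-1.

Definition subgroup A : Prop := group_closed [in A].

Definition commutator_subgroup A B : set G :=
  smallest subgroup [set comm x y | x in A & y in B].

Lemma commV x y : (comm x y)^-1 = comm y x.
Proof. by rewrite /comm !invgM !invgK !mulgA. Qed.

Lemma commxx x : comm x x = 1.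
Proof. by rewrite /comm mulgK mulgV. Qed.

Lemma comm1l x : comm 1 x = 1.
Proof. by rewrite /comm mul1g invg1 mulg1 mulgV. Qed.

Lemma comm_conj x y : x * y * x^-1 = comm x y * y.
Proof. by rewrite /comm mulgVK. Qed.

Lemma commMl x x' y : comm (x * x') y = (x * comm x' y * x^-1) * comm x y.
Proof. by rewrite /comm !invgM !mulgA !mulgVK. Qed.

Lemma Hall_Witt x y z :
  comm (comm x y) (y * z * y^-1) * comm (comm y z) (z * x * z^-1)
    * comm (comm z x) (x * y * x^-1) = 1.
Proof.
by rewrite /comm; do !rewrite ?invgM ?invgK ?mulgA ?mulgVK ?mulgK ?mulgV ?mul1g.
Qed.

End Commutator.

(* fil i is G_i for i >= 1; the set fil 0 is unconstrained and never used. *)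
Record scfType := SCF {
  scf_group :> groupType;
  fil : nat -> set scf_group;
  fil_subgroup : forall i, (0 < i)%N -> subgroup (fil i);
  fil1 : fil 1 = setT;
  fil_decr : forall i, (0 < i)%N -> fil i.+1 `<=` fil i;
  fil_comm : forall i j, (0 < i)%N -> (0 < j)%N ->
    commutator_subgroup (fil i) (fil j) `<=` fil (i + j)
}.
Arguments fil : clear implicits.
Arguments fil_subgroup G {i} : rename.

Record scfHom (G H : scfType) := SCFHom {
  scf_morph :> {multiplicative G -> H};
  scf_morph_fil : forall i, (0 < i)%N -> scf_morph @` fil G i `<=` fil H i
}.

Section SCFCategory.
Local Open Scope group_scope.

Fact id_fil (G : scfType) i : (0 < i)%N -> @idfun G @` fil G i `<=` fil G i.
Proof. by move=> _ _ [x xi <-]. Qed.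

Definition scf_id (G : scfType) : scfHom G G := SCFHom (@id_fil G).

Variables G H K : scfType.

Fact comp_fil (v : scfHom H K) (u : scfHom G H) i : (0 < i)%N ->
  (v \o u) @` fil G i `<=` fil K i.
Proof.
move=> i0 _ [x xi <-]; apply: (scf_morph_fil (s := v) i0).
by exists (u x) => //; apply: (scf_morph_fil (s := u) i0); exists x.
Qed.

Definition scf_comp (v : scfHom H K) (u : scfHom G H) : scfHom G K :=
  SCFHom (@comp_fil v u).

(* v is a regular epimorphism of filtrations and u is its kernel, spelled out. *)
Definition scf_short_exact (u : scfHom G H) (v : scfHom H K) : Prop :=
  [/\ injective u, range u = [set h | v h = 1], range v = setT,
      forall i, (0 < i)%N -> u @^-1` fil H i = fil G i &
      forall i, (0 < i)%N -> v @` fil H i = fil K i].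

End SCFCategory.

HB.mixin Record Zmodule_isLieRing L of GRing.Zmodule L := {
  lie : L -> L -> L;
  lieDl : forall z, {morph lie^~ z : x y / (x + y)%R};
  lieDr : forall z, {morph lie z : x y / (x + y)%R};
  liexx : forall x, lie x x = 0%R;
  lie_jacobi : forall x y z,
    (lie x (lie y z) + lie y (lie z x) + lie z (lie x y) = 0)%R
}.

#[short(type="lieRingType")]
HB.structure Definition LieRing := {L of GRing.Zmodule L & Zmodule_isLieRing L}.

Record lieHom (L M : lieRingType) := LieHom {
  lie_morph :> {additive L -> M};
  lie_morph_lie : {morph lie_morph : x y / lie x y}
}.

(* In Lie rings the regular epimorphisms are the surjections. *)
Definition lie_short_exact (L M N : lieRingType)
    (f : lieHom L M) (g : lieHom M N) : Prop :=
  [/\ injective f, range f = [set y | g y = 0%R] & range g = setT].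

Section Graded.
Variables (G : scfType) (n : nat).
Local Open Scope group_scope.

Lemma fil_one i : (0 < i)%N -> 1 \in fil G i.
Proof. by move=> i0; case: (fil_subgroup G i0). Qed.

Lemma fil_mul i x y : (0 < i)%N ->
  x \in fil G i -> y \in fil G i -> x * y \in fil G i.
Proof. by move=> i0; apply: group_closedM (fil_subgroup G i0) x y. Qed.

Lemma fil_inv i x : (0 < i)%N -> x \in fil G i -> x^-1 \in fil G i.
Proof. by move=> i0; apply: group_closedV (fil_subgroup G i0) x. Qed.

Lemma fil_le i j x : (0 < i)%N -> (i <= j)%N -> x \in fil G j -> x \in fil G i.
Proof.
move=> i0 /subnKC <-; elim: (j - i)%N => [|k IHk]; rewrite ?addn0 // addnS.
by move=> /set_mem /fil_decr xk; apply/IHk/mem_set/xk; rewrite addn_gt0 i0.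
Qed.

Lemma fil_commg i j x y : (0 < i)%N -> (0 < j)%N ->
  x \in fil G i -> y \in fil G j -> comm x y \in fil G (i + j).
Proof.
move=> i0 j0 /set_mem xi /set_mem yj; apply/mem_set/fil_comm => //.
by apply: sub_gen_smallest; exists x => //; exists y.
Qed.

Lemma fil_conj i x y : (0 < i)%N -> y \in fil G i -> x * y * x^-1 \in fil G i.
Proof.
move=> i0 yi; rewrite comm_conj fil_mul //.
have xT : x \in fil G 1 by rewrite fil1; exact: mem_set.
exact/(fil_le i0 (leqnSn i))/(fil_commg (ltn0Sn 0) i0 xT yi).
Qed.

Definition fil_sub : Type := {x : G | x \in fil G n.+1}.

HB.instance Definition _ := [isSub of fil_sub for @sval _ _].
HB.instance Definition _ := [Choice of fil_sub by <:].

Definition gr_eq (x y : fil_sub) : bool := val x / val y \in fil G n.+2.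

Lemma gr_eq_equiv : equiv_class_of gr_eq.
Proof.
split=> [x|x y|y x z]; rewrite /gr_eq.
- by rewrite mulgV fil_one.
- by apply/idP/idP => /fil_inv; rewrite invgM invgK; apply.
- by move=> xy yz; rewrite -[val x](mulgVK (val y)) -mulgA fil_mul.
Qed.

Canonical gr_equiv := EquivRelPack gr_eq_equiv.

(* The homogeneous component of degree n + 1, i.e. G_(n+1) / G_(n+2). *)
Definition gr : Type := {eq_quot gr_equiv}.

HB.instance Definition _ := Choice.on gr.

Definition fil_sub1 : fil_sub := exist _ 1 (fil_one (ltn0Sn n)).

(* cls x is the class of x, for x in G_(n+1), and a junk value otherwise. *)
Definition cls (x : G) : gr := \pi_({eq_quot gr_equiv})%qT (insubd fil_sub1 x).
Definition rep (a : gr) : G := val (@repr _ {eq_quot gr_equiv} a).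

Lemma rep_fil a : rep a \in fil G n.+1.
Proof. exact: valP. Qed.

Lemma repK : cancel rep cls.
Proof. by move=> a; rewrite /cls /rep valKd; exact: reprK. Qed.

Lemma clsP x y : x \in fil G n.+1 -> y \in fil G n.+1 ->
  reflect (cls x = cls y) (x / y \in fil G n.+2).
Proof.
move=> xn yn; apply: (iffP idP) => [xy|/eqmodP /=].
  by apply/eqmodP; rewrite /= /gr_eq !insubdK.
by rewrite /gr_eq !insubdK.
Qed.

Lemma rep_cls x : x \in fil G n.+1 -> rep (cls x) / x \in fil G n.+2.
Proof. by move=> xn; apply/(clsP (rep_fil _) xn); rewrite repK. Qed.

Definition gr_zero : gr := cls 1.
Definition gr_opp (a : gr) : gr := cls (rep a)^-1.
Definition gr_add (a b : gr) : gr := cls (rep a * rep b).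

Lemma cls_mul x y : x \in fil G n.+1 -> y \in fil G n.+1 ->
  cls (x * y) = gr_add (cls x) (cls y).
Proof.
move=> xn yn; apply/esym/clsP; [by rewrite fil_mul ?rep_fil|exact: fil_mul|].
set x' := rep _; set y' := rep _.
have -> : x' * y' / (x * y) = x' * (y' / y) * x'^-1 * (x' / x).
  by rewrite invgM !mulgA mulgVK.
by rewrite fil_mul ?fil_conj ?rep_cls.
Qed.

Lemma gr_addA : associative gr_add.
Proof.
move=> a b c; rewrite -[a]repK -[b]repK -[c]repK.
by rewrite -!cls_mul ?mulgA ?fil_mul ?rep_fil.
Qed.

Lemma gr_addC : commutative gr_add.
Proof.
move=> a b; apply/clsP; [by rewrite fil_mul ?rep_fil ..|].
suff : comm (rep a) (rep b) \in fil G n.+2 by rewrite /comm invgM !mulgA.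
by apply: fil_le (fil_commg _ _ (rep_fil a) (rep_fil b)); rewrite // addSnnS leq_addl.
Qed.

Lemma gr_add0 : left_id gr_zero gr_add.
Proof.
by move=> a; rewrite -[a in LHS]repK -cls_mul ?mul1g ?repK ?fil_one ?rep_fil.
Qed.

Lemma gr_addN : left_inverse gr_zero gr_opp gr_add.
Proof.
by move=> a; rewrite -{2}[a]repK -cls_mul ?mulVg ?fil_inv ?rep_fil.
Qed.

HB.instance Definition _ :=
  GRing.isZmodule.Build gr gr_addA gr_addC gr_add0 gr_addN.

Lemma clsM x y : x \in fil G n.+1 -> y \in fil G n.+1 ->
  cls (x * y) = (cls x + cls y)%R.
Proof. exact: cls_mul. Qed.

Lemma cls1 : cls 1 = 0%R. Proof. by []. Qed.

Lemma cls_eq0 x : x \in fil G n.+2 -> cls x = 0%R.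
Proof.
move=> xn; apply/clsP; rewrite ?invg1 ?mulg1 ?fil_one //.
exact: fil_le xn.
Qed.

Lemma cls_conj x y : y \in fil G n.+1 -> cls (x * y * x^-1) = cls y.
Proof.
move=> yn; apply/clsP; rewrite ?fil_conj //.
have xT : x \in fil G 1 by rewrite fil1; exact: mem_set.
by have := fil_commg (ltn0Sn 0) (ltn0Sn n) xT yn.
Qed.

End Graded.

(* Degrees i + 1 and j + 1 add up to (i + j).+1 + 1. By gr_lie_cls, the result
   does not depend on the representatives. *)
Definition gr_lie (G : scfType) i j (a : gr G i) (b : gr G j) :
    gr G (i + j).+1 :=
  cls (i + j).+1 (comm (rep a) (rep b)).

Section GradedLie.
Variables (G : scfType) (i j : nat).
Implicit Types (x y : G) (a : gr G i) (b : gr G j).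
Local Open Scope group_scope.

Lemma fil_commS x y : x \in fil G i.+1 -> y \in fil G j.+1 ->
  comm x y \in fil G (i + j).+2.
Proof. by move=> xi yj; have := fil_commg _ _ xi yj; rewrite !(addSn, addnS); apply. Qed.

Lemma cls_commDl x x' y : x \in fil G i.+1 -> x' \in fil G i.+1 ->
    y \in fil G j.+1 ->
  cls (i + j).+1 (comm (x * x') y)
    = (cls _ (comm x y) + cls _ (comm x' y))%R.
Proof.
move=> xi x'i yj; rewrite commMl clsM ?fil_conj ?fil_commS //.
by rewrite cls_conj ?fil_commS // addrC.
Qed.

Lemma cls_commDr x y y' : x \in fil G i.+1 -> y \in fil G j.+1 ->
    y' \in fil G j.+1 ->
  cls (i + j).+1 (comm x (y * y'))
    = (cls _ (comm x y) + cls _ (comm x y'))%R.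
Proof.
move=> xi yj y'j.
have -> : comm x (y * y') = comm x y * (y * comm x y' * y^-1).
  by rewrite /comm !invgM !mulgA !mulgVK.
by rewrite clsM ?fil_conj ?fil_commS // cls_conj ?fil_commS.
Qed.

Lemma gr_lie_cls x y : x \in fil G i.+1 -> y \in fil G j.+1 ->
  gr_lie (cls i x) (cls j y) = cls _ (comm x y).
Proof.
move=> xi yj; rewrite /gr_lie.
have x'i := rep_cls xi; have y'j := rep_cls yj.
rewrite -[rep (cls i x)](mulgVK x) cls_commDl ?rep_fil //; last exact: fil_le x'i.
rewrite [X in (X + _)%R]cls_eq0 ?add0r; last first.
  by have := fil_commg _ _ x'i (rep_fil (cls j y)); rewrite !(addSn, addnS); apply.
rewrite -[rep (cls j y)](mulgVK y) cls_commDr //; last exact: fil_le y'j.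
rewrite [X in (X + _)%R]cls_eq0 ?add0r //.
by have := fil_commg _ _ xi y'j; rewrite !(addSn, addnS); apply.
Qed.

Lemma gr_lieDl b : {morph (fun a => gr_lie a b) : a a' / (a + a')%R}.
Proof.
move=> a a'; rewrite -[a in LHS]repK -[a' in LHS]repK -[b in LHS]repK.
by rewrite -clsM ?gr_lie_cls ?cls_commDl ?fil_mul ?rep_fil.
Qed.

Lemma gr_lieDr a : {morph (fun b => gr_lie a b) : b b' / (b + b')%R}.
Proof.
move=> b b'; rewrite -[a in LHS]repK -[b in LHS]repK -[b' in LHS]repK.
by rewrite -clsM ?gr_lie_cls ?cls_commDr ?fil_mul ?rep_fil.
Qed.

Lemma gr_lie0l b : gr_lie (0%R : gr G i) b = 0%R.
Proof. by apply: (addIr (gr_lie (0%R : gr G i) b)); rewrite -gr_lieDl !add0r. Qed.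

Lemma gr_lie0r a : gr_lie a (0%R : gr G j) = 0%R.
Proof. by apply: (addIr (gr_lie a (0%R : gr G j))); rewrite -gr_lieDr !add0r. Qed.

End GradedLie.

Local Open Scope ring_scope.

Record dsum (V : nat -> zmodType) := DSum {
  dsum_fun :> forall n, V n;
  dsumP : exists N, forall n, (N <= n)%N -> dsum_fun n = 0
}.

Section DirectSum.
Variable V : nat -> zmodType.
Implicit Types f g : dsum V.

HB.instance Definition _ := gen_eqMixin (dsum V).
HB.instance Definition _ := gen_choiceMixin (dsum V).

Lemma dsum_eq f g : (forall n, f n = g n) -> f = g.
Proof.
case: f g => [f fP] [g gP] /= fg.
have {}fg : f = g by exact: functional_extensionality_dep.
by subst g; congr DSum; exact: Prop_irrelevance.
Qed.

Fact dsum_zeroP : exists N, forall n, (N <= n)%N -> (fun n => 0 : V n) n = 0.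
Proof. by exists 0. Qed.

Fact dsum_oppP f : exists N, forall n, (N <= n)%N -> (fun n => - f n) n = 0.
Proof. by have [N fN] := dsumP f; exists N => n /fN ->; rewrite oppr0. Qed.

Fact dsum_addP f g :
  exists N, forall n, (N <= n)%N -> (fun n => f n + g n) n = 0.
Proof.
have [N fN] := dsumP f; have [M gM] := dsumP g; exists (maxn N M) => n.
by rewrite geq_max => /andP[/fN -> /gM ->]; rewrite addr0.
Qed.

Definition dsum_zero : dsum V := DSum dsum_zeroP.
Definition dsum_opp f : dsum V := DSum (dsum_oppP f).
Definition dsum_add f g : dsum V := DSum (dsum_addP f g).

Fact dsum_addA : associative dsum_add.
Proof. by move=> f g h; apply: dsum_eq => n /=; rewrite addrA. Qed.
Fact dsum_addC : commutative dsum_add.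
Proof. by move=> f g; apply: dsum_eq => n /=; rewrite addrC. Qed.
Fact dsum_add0 : left_id dsum_zero dsum_add.
Proof. by move=> f; apply: dsum_eq => n /=; rewrite add0r. Qed.
Fact dsum_addN : left_inverse dsum_zero dsum_opp dsum_add.
Proof. by move=> f; apply: dsum_eq => n /=; rewrite addNr. Qed.

HB.instance Definition _ :=
  GRing.isZmodule.Build (dsum V) dsum_addA dsum_addC dsum_add0 dsum_addN.

Lemma dsumD f g n : (f + g) n = f n + g n. Proof. by []. Qed.
Lemma dsum0 n : (0 : dsum V) n = 0. Proof. by []. Qed.
Lemma dsum_sum I (r : seq I) (F : I -> dsum V) n :
  (\sum_(i <- r) F i) n = \sum_(i <- r) F i n.
Proof. by elim/big_rec2: _ => //= i a b _ <-. Qed.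

Definition inj_fun n (a : V n) : forall m, V m :=
  @dfwith _ V (fun=> 0) n a.

Fact inj_funP n (a : V n) : exists N, forall m, (N <= m)%N -> inj_fun a m = 0.
Proof.
exists n.+1 => m nm; rewrite /inj_fun dfwith_out //.
by apply: contraTneq nm => ->; rewrite ltnn.
Qed.

Definition inj n (a : V n) : dsum V := DSum (inj_funP a).

Lemma inj_in n (a : V n) : inj a n = a.
Proof. exact: dfwith_in. Qed.

Lemma inj_out n (a : V n) m : n != m -> inj a m = 0.
Proof. exact: dfwith_out. Qed.

Lemma injD n : {morph @inj n : a b / a + b}.
Proof.
move=> a b; apply: dsum_eq => m; rewrite dsumD.
by have [<-|nm] := eqVneq n m; rewrite ?inj_in ?inj_out ?addr0.
Qed.

Lemma inj0 n : inj (0 : V n) = 0.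
Proof. by apply: (addIr (inj (0 : V n))); rewrite -injD !add0r. Qed.

Definition bound f : nat := projT1 (cid (dsumP f)).

Lemma boundP f n : (bound f <= n)%N -> f n = 0.
Proof. by rewrite /bound; case: cid => /= N fN /fN. Qed.

Lemma dsum_decomp f : f = \sum_(i < bound f) inj (f i).
Proof.
apply: dsum_eq => n; rewrite dsum_sum.
have [nf|fn] := ltnP n (bound f).
  rewrite (bigD1 (Ordinal nf)) //= {1}/inj_fun dfwith_in.
  by rewrite big1 ?addr0 // => i ni; rewrite /inj_fun dfwith_out.
rewrite boundP // big1 // => i _; rewrite inj_out //.
by apply: contraTneq fn => <-; rewrite -ltnNge.
Qed.

Lemma dsum_ind (P : dsum V -> Prop) :
  P 0 -> (forall f g, P f -> P g -> P (f + g)) ->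
  (forall n (a : V n), P (inj a)) -> forall f, P f.
Proof.
by move=> P0 PD Pinj f; rewrite (dsum_decomp f); apply: big_ind.
Qed.

End DirectSum.

Section LieObject.
Variable G : scfType.
Implicit Types f g h : dsum (fun n => gr G n).

Definition Lie : Type := dsum (fun n => gr G n).

HB.instance Definition _ := GRing.Zmodule.on Lie.

(* The biadditive extension of gr_lie; the value does not depend on the bounds
   beyond which the components vanish. *)
Definition Lie_lie (f g : Lie) : Lie :=
  \sum_(i < bound f) \sum_(j < bound g)
    (inj (V := fun n => gr G n) (gr_lie (f i) (g j)) : Lie).

Lemma Lie_lieE N M f g :
    (forall n, (N <= n)%N -> f n = 0) -> (forall n, (M <= n)%N -> g n = 0) ->
  Lie_lie f g = \sum_(i < N) \sum_(j < M)
    inj (V := fun n => gr G n) (gr_lie (f i) (g j)).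
Proof.
pose T i j := inj (V := fun n => gr G n) (gr_lie (f i) (g j)).
have T0l i j : f i = 0 -> T i j = 0 by rewrite /T => ->; rewrite gr_lie0l inj0.
have T0r i j : g j = 0 -> T i j = 0 by rewrite /T => ->; rewrite gr_lie0r inj0.
have wid (F : nat -> Lie) A B : (forall n, (A <= n)%N -> F n = 0) ->
    (forall n, (B <= n)%N -> F n = 0) -> \sum_(i < A) F i = \sum_(i < B) F i.
  wlog AB : A B / (A <= B)%N => [W FA FB|FA _].
    by have [/W ->|/ltnW/W ->] := leqP A B.
  rewrite -!(big_mkord predT F) (big_cat_nat _ AB) //= [X in _ + X]big_nat_cond.
  by rewrite [X in _ + X]big1 ?addr0 // => i /andP[/andP[/FA]].
move=> fN gM; rewrite /Lie_lie.
rewrite (wid (fun i => \sum_(j < bound g) T i j) _ N); first last.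
- by move=> n /fN f0; rewrite big1 // => j _; exact: T0l.
- by move=> n /boundP f0; rewrite big1 // => j _; exact: T0l.
apply: eq_bigr => i _.
by apply: (wid (T i)) => n => [/boundP|/gM]; exact: T0r.
Qed.

Lemma Lie_lieDl g : {morph Lie_lie^~ g : f f' / f + f'}.
Proof.
move=> f f'; pose N := maxn (bound f) (bound f').
have fN n : (N <= n)%N -> f n = 0 by rewrite geq_max => /andP[/boundP].
have f'N n : (N <= n)%N -> f' n = 0 by rewrite geq_max => /andP[_ /boundP].
rewrite (Lie_lieE (N := N) (M := bound g)); first last.
- exact: boundP.
- by move=> n Nn; rewrite dsumD fN ?f'N ?addr0.
rewrite (Lie_lieE fN (@boundP _ g)) (Lie_lieE f'N (@boundP _ g)) -big_split.
apply: eq_bigr => i _; rewrite -big_split; apply: eq_bigr => j _ /=.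
by rewrite -injD -gr_lieDl.
Qed.

Lemma Lie_lieDr f : {morph Lie_lie f : g g' / g + g'}.
Proof.
move=> g g'; pose N := maxn (bound g) (bound g').
have gN n : (N <= n)%N -> g n = 0 by rewrite geq_max => /andP[/boundP].
have g'N n : (N <= n)%N -> g' n = 0 by rewrite geq_max => /andP[_ /boundP].
rewrite (Lie_lieE (N := bound f) (M := N)); first last.
- by move=> n Nn; rewrite dsumD gN ?g'N ?addr0.
- exact: boundP.
rewrite (Lie_lieE (@boundP _ f) gN) (Lie_lieE (@boundP _ f) g'N) -big_split.
apply: eq_bigr => i _; rewrite -big_split; apply: eq_bigr => j _ /=.
by rewrite -injD -gr_lieDr.
Qed.

Lemma Lie_lie0l g : Lie_lie 0 g = 0.
Proof. by apply: (addIr (Lie_lie 0 g)); rewrite -Lie_lieDl !add0r. Qed.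

Lemma Lie_lie0r f : Lie_lie f 0 = 0.
Proof. by apply: (addIr (Lie_lie f 0)); rewrite -Lie_lieDr !add0r. Qed.

Lemma Lie_lie_inj i j (a : gr G i) (b : gr G j) :
  Lie_lie (inj (V := fun n => gr G n) a) (inj (V := fun n => gr G n) b)
    = inj (V := fun n => gr G n) (gr_lie a b).
Proof.
have out k (c : gr G k) n : (k.+1 <= n)%N -> inj (V := fun n => gr G n) c n = 0.
  by move=> kn; rewrite inj_out // neq_ltn kn.
rewrite (Lie_lieE (out i a) (out j b)) big_ord_recr big1 /= ?add0r; last first.
  move=> k _; rewrite big1 // => l _.
  by rewrite /inj_fun dfwith_out ?gr_lie0l ?inj0 // neq_ltn ltn_ord orbT.
rewrite big_ord_recr big1 /= ?add0r /inj_fun ?dfwith_in // => l _.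
by rewrite [X in gr_lie _ X]dfwith_out ?gr_lie0r ?inj0 // neq_ltn ltn_ord orbT.
Qed.

(* The element of L(G) given by the class of x in degree n + 1. *)
Definition hom n (x : G) : Lie := inj (V := fun n => gr G n) (cls n x).

Lemma homM n x y : x \in fil G n.+1 -> y \in fil G n.+1 ->
  hom n (x * y)%g = hom n x + hom n y.
Proof. by move=> xn yn; rewrite /hom clsM // injD. Qed.

Lemma hom1 n : hom n 1%g = 0.
Proof. by rewrite /hom cls1 inj0. Qed.

Lemma homV n x : x \in fil G n.+1 -> hom n x^-1%g = - hom n x.
Proof.
move=> xn; apply/eqP; rewrite -addr_eq0 -homM ?fil_inv //.
by rewrite mulVg hom1.
Qed.

Lemma Lie_lie_hom i j x y : x \in fil G i.+1 -> y \in fil G j.+1 ->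
  Lie_lie (hom i x) (hom j y) = hom (i + j).+1 (comm x y).
Proof. by move=> xi yj; rewrite Lie_lie_inj gr_lie_cls. Qed.

Lemma Lie_ind (P : Lie -> Prop) :
  P 0 -> (forall f g, P f -> P g -> P (f + g)) ->
  (forall n x, x \in fil G n.+1 -> P (hom n x)) -> forall f, P f.
Proof.
move=> P0 PD Ph; apply: dsum_ind => // n a.
by rewrite -[a]repK; apply: Ph; exact: rep_fil.
Qed.

Lemma Lie_lieC f g : Lie_lie f g = - Lie_lie g f.
Proof.
elim/Lie_ind: f => [|f f' IH IH'|i x xi].
- by rewrite Lie_lie0l Lie_lie0r oppr0.
- by rewrite Lie_lieDl Lie_lieDr IH IH' opprD.
elim/Lie_ind: g => [|f f' IH IH'|j y yj].
- by rewrite Lie_lie0l Lie_lie0r oppr0.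
- by rewrite Lie_lieDl Lie_lieDr IH IH' opprD.
rewrite !Lie_lie_hom // addnC -homV ?commV //.
exact: fil_commS.
Qed.

Fact Lie_liexx f : Lie_lie f f = 0.
Proof.
elim/Lie_ind: f => [|f f' IH IH'|i x xi].
- by rewrite Lie_lie0l.
- by rewrite Lie_lieDl !Lie_lieDr IH IH' add0r addr0 Lie_lieC addNr.
- by rewrite Lie_lie_hom // commxx hom1.
Qed.

Fact Lie_jacobi f g h :
  Lie_lie f (Lie_lie g h) + Lie_lie g (Lie_lie h f)
    + Lie_lie h (Lie_lie f g) = 0.
Proof.
have addACA3 (a b c a' b' c' : Lie) :
  (a + a') + (b + b') + (c + c') = (a + b + c) + (a' + b' + c').
  by rewrite (addrACA a) (addrACA (a + b)).
elim/Lie_ind: f => [|f f' IH IH'|i x xi].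
- by rewrite !(Lie_lie0l, Lie_lie0r) !addr0.
- by rewrite !(Lie_lieDl, Lie_lieDr) addACA3 IH IH' addr0.
elim/Lie_ind: g => [|f f' IH IH'|j y yj].
- by rewrite !(Lie_lie0l, Lie_lie0r) !addr0.
- by rewrite !(Lie_lieDl, Lie_lieDr) addACA3 IH IH' addr0.
elim/Lie_ind: h => [|f f' IH IH'|k z zk].
- by rewrite !(Lie_lie0l, Lie_lie0r) !addr0.
- by rewrite !(Lie_lieDl, Lie_lieDr) addACA3 IH IH' addr0.
have lieNC a b c : Lie_lie a (Lie_lie b c) = - Lie_lie (Lie_lie b c) a.
  exact: Lie_lieC.
rewrite !lieNC -!opprD [X in - X]addrC addrA.
have conj n u v : v \in fil G n.+1 -> hom n v = hom n (u * v * u^-1)%g.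
  by move=> vn; rewrite /hom cls_conj.
rewrite {1}(conj k y z zk) {2}(conj i z x xi) {3}(conj j x y yj).
rewrite !Lie_lie_hom ?fil_commS ?fil_conj //.
have -> : ((j + k).+1 + i = (i + j).+1 + k)%N by rewrite !addSn addnC addnA.
have -> : ((k + i).+1 + j = (i + j).+1 + k)%N.
  by rewrite !addSn -addnA addnC.
have F1 : comm (comm x y) (y * z * y^-1)%g \in fil G ((i + j).+1 + k).+2.
  by rewrite fil_commS ?fil_commS ?fil_conj.
have F2 : comm (comm y z) (z * x * z^-1)%g \in fil G ((i + j).+1 + k).+2.
  have -> : ((i + j).+1 + k = (j + k).+1 + i)%N by rewrite !addSn -addnA addnC.
  by rewrite fil_commS ?fil_commS ?fil_conj.
have F3 : comm (comm z x) (x * y * x^-1)%g \in fil G ((i + j).+1 + k).+2.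
  have -> : ((i + j).+1 + k = (k + i).+1 + j)%N.
    by rewrite !addSn addnC addnA.
  by rewrite fil_commS ?fil_commS ?fil_conj.
have F12 := fil_mul (ltn0Sn _) F1 F2.
by rewrite -(homM F1 F2) -(homM F12 F3) Hall_Witt hom1 oppr0.
Qed.

HB.instance Definition _ :=
  Zmodule_isLieRing.Build Lie Lie_lieDl Lie_lieDr Lie_liexx Lie_jacobi.

End LieObject.

Section LieMorphism.
Variables (G H : scfType) (u : scfHom G H).

Definition gr_map n (a : gr G n) : gr H n := cls n (u (rep a)).

Lemma scf_fil n x : x \in fil G n.+1 -> u x \in fil H n.+1.
Proof.
move=> /set_mem xn; apply/mem_set/(scf_morph_fil (s := u) (ltn0Sn n)).
by exists x.
Qed.

Lemma scf_morph1 : u 1%g = 1%g.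
Proof. by apply: (mulIg (u 1%g)); rewrite -gmulfM !mul1g. Qed.

Lemma scf_morphV x : u x^-1%g = (u x)^-1%g.
Proof. by apply: (mulIg (u x)); rewrite -gmulfM !mulVg scf_morph1. Qed.

Lemma scf_morph_comm x y : u (comm x y) = comm (u x) (u y).
Proof. by rewrite /comm !gmulfM !scf_morphV. Qed.

Lemma gr_map_cls n x : x \in fil G n.+1 -> gr_map (cls n x) = cls n (u x).
Proof.
move=> xn; apply/clsP; rewrite ?scf_fil ?rep_fil //.
by rewrite -scf_morphV -gmulfM scf_fil ?rep_cls.
Qed.

Lemma gr_mapD n : {morph @gr_map n : a b / a + b}.
Proof.
move=> a b; rewrite -[a in LHS]repK -[b in LHS]repK -clsM ?rep_fil //.
by rewrite gr_map_cls ?fil_mul ?rep_fil // gmulfM clsM ?scf_fil ?rep_fil.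
Qed.

Lemma gr_map0 n : @gr_map n 0 = 0.
Proof. by apply: (addIr (@gr_map n 0)); rewrite -gr_mapD !add0r. Qed.

Fact Lie_mapP (f : Lie G) :
  exists N, forall n, (N <= n)%N -> (fun n => gr_map (f n)) n = 0.
Proof. by have [N fN] := dsumP f; exists N => n /fN ->; rewrite gr_map0. Qed.

Definition Lie_fun (f : Lie G) : Lie H :=
  DSum (V := fun n => gr H n) (Lie_mapP f).

Fact Lie_funD : {morph Lie_fun : f g / f + g}.
Proof. by move=> f g; apply: dsum_eq => n; exact: gr_mapD. Qed.

Fact Lie_fun0 : Lie_fun 0 = 0.
Proof. by apply: (addIr (Lie_fun 0)); rewrite -Lie_funD !add0r. Qed.

Fact Lie_funB : {morph Lie_fun : f g / f - g}.
Proof.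
by move=> f g; apply: (addIr (Lie_fun g)); rewrite -Lie_funD !subrK.
Qed.

HB.instance Definition _ :=
  GRing.isZmodMorphism.Build (Lie G) (Lie H) Lie_fun Lie_funB.

Lemma Lie_fun_hom n x : x \in fil G n.+1 -> Lie_fun (hom n x) = hom n (u x).
Proof.
move=> xn; apply: dsum_eq => m; rewrite /= /inj_fun; have [<-|nm] := eqVneq n m.
  by rewrite !dfwith_in gr_map_cls.
by rewrite !dfwith_out // gr_map0.
Qed.

Fact Lie_fun_Lie_lie : {morph Lie_fun : f g / Lie_lie f g}.
Proof.
move=> f g; elim/Lie_ind: f => [|f f' IH IH'|i x xi].
- by rewrite !(Lie_lie0l, Lie_fun0).
- by rewrite !(Lie_lieDl, Lie_funD) IH IH'.
elim/Lie_ind: g => [|f f' IH IH'|j y yj].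
- by rewrite !(Lie_lie0r, Lie_fun0).
- by rewrite !(Lie_lieDr, Lie_funD) IH IH'.
by rewrite Lie_lie_hom // !Lie_fun_hom ?fil_commS // Lie_lie_hom ?scf_fil //
  scf_morph_comm.
Qed.

Fact Lie_fun_lie : {morph Lie_fun : f g / lie f g}.
Proof. exact: Lie_fun_Lie_lie. Qed.

Definition Lie_map : lieHom (Lie G) (Lie H) := LieHom Lie_fun_lie.

End LieMorphism.

Lemma Lie_map_id (G : scfType) : Lie_map (scf_id G) =1 id.
Proof. by move=> f; apply: dsum_eq => n; exact: repK. Qed.

Lemma Lie_map_comp (G H K : scfType) (v : scfHom H K) (u : scfHom G H) :
  Lie_map (scf_comp v u) =1 Lie_map v \o Lie_map u.
Proof.
move=> f; apply: dsum_eq => n.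
by rewrite /= gr_map_cls ?scf_fil ?rep_fil.
Qed.

(* Main.v *)
From mathcomp Require Import all_boot ssralg.
From mathcomp Require Import boolp classical_sets.
Require Import Defs.

(** The map induced on [L] is the direct sum of the maps on the graded pieces,
    so exactness is checked degree by degree on representatives. The kernel
    condition [u^-1(H_i) = G_i] gives injectivity, [v(H_i) = K_i] gives
    surjectivity. If [v y] lies in [K_(n+2)], then correcting [y] by an element
    of [H_(n+2)] with the same image moves it into [ker v = u(G)] without
    changing its class. *)

Import GRing.Theory.
Local Open Scope classical_set_scope.
Local Open Scope ring_scope.

(** Passes from single degrees to direct sums, both for surjectivity and for exactness in the
    middle. *)
Lemma dsum_lift (V W : nat -> zmodType) (phi : forall n, V n -> W n)
    (g : dsum W) :
  (forall n, phi n 0 = 0) -> (forall n, exists a, phi n a = g n) ->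
  exists f : dsum V, forall n, phi n (f n) = g n.
Proof.
move=> phi0 phig; have [N gN] := dsumP g.
(* A chosen preimage of 0 need not be 0, so 0 is imposed from [N] on to keep the support finite. *)
pose f n : V n := if (N <= n)%N then 0 else projT1 (cid (phig n)).
have fP : exists M, forall n, (M <= n)%N -> f n = 0.
  by exists N => n Nn; rewrite /f Nn.
exists (DSum fP) => n /=; rewrite /f.
by case: ifPn => [/gN ->|_]; [exact: phi0|case: cid].
Qed.

Section Exactness.
Variables (G H K : scfType) (u : scfHom G H) (v : scfHom H K).

Lemma scf_morph_div x y : u (x / y)%g = (u x / u y)%g.
Proof. by rewrite gmulfM scf_morphV. Qed.

Lemma gr_map_inj n :
  u @^-1` fil H n.+2 = fil G n.+2 -> injective (@gr_map G H u n).
Proof.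
move=> uG a b ab; rewrite -[a]repK -[b]repK; apply/clsP; rewrite ?rep_fil //.
(* Equality of the image classes says that [u (rep a / rep b)] lies in H_(n+2). *)
move/clsP: ab; rewrite !scf_fil ?rep_fil // -scf_morph_div => /(_ isT isT).
by move=> /set_mem uab; apply/mem_set; rewrite -uG.
Qed.

Lemma gr_map_surj n (c : gr K n) :
  v @` fil H n.+1 = fil K n.+1 -> exists b, gr_map v b = c.
Proof.
move=> vH; have /set_mem := rep_fil c; rewrite -vH => -[y /mem_set yn vy].
by exists (cls n y); rewrite gr_map_cls // vy repK.
Qed.

Lemma gr_map_exact n (b : gr H n) :
    range u = [set h | v h = 1%g] -> u @^-1` fil H n.+1 = fil G n.+1 ->
    v @` fil H n.+2 = fil K n.+2 ->
  gr_map v b = 0 -> exists a, gr_map u a = b.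
Proof.
move=> ukerv uG vH; rewrite -[b]repK; set y := rep b.
have yn : y \in fil H n.+1 by exact: rep_fil.
rewrite gr_map_cls // -cls1 => /clsP; rewrite scf_fil ?fil_one // => /(_ isT isT).
rewrite invg1 mulg1 => /set_mem; rewrite -vH => -[z /mem_set zn vzy].
have zn1 : z \in fil H n.+1 by exact: fil_le zn.
have [x _ uxyz] : range u (y / z)%g.
  by rewrite ukerv /= gmulfM scf_morphV vzy mulgV.
have yzn : (y / z)%g \in fil H n.+1 by rewrite fil_mul ?fil_inv.
(* Exactness of the groups only gives [x] in G_1; the kernel condition in degree n+1 puts it in
   G_(n+1), where [cls n x] is not a junk value. *)
have xn : x \in fil G n.+1.
  by apply/mem_set; rewrite -uG /preimage/= uxyz; exact: set_mem.
exists (cls n x); rewrite gr_map_cls // uxyz; apply/clsP => //.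
(* The quotient (y/z)/y is the conjugate of z^-1 by y, hence in H_(n+2). *)
by rewrite fil_conj ?fil_inv.
Qed.

End Exactness.

Theorem proposition1p24 (G H K : scfType) (u : scfHom G H) (v : scfHom H K) :
  scf_short_exact u v -> lie_short_exact (Lie_map u) (Lie_map v).
Proof.
case=> _ ukerv _ uG vH; split=> [f g fg||].
- apply: dsum_eq => n; apply: (gr_map_inj _ _ u); first exact: uG.
  exact: (congr1 (fun h : Lie H => h n) fg).
- apply/seteqP; split=> [_ [f _ <-]|g /= vg0].
    (* The composite vanishes already on representatives, since [u] maps into the kernel of [v]. *)
    apply: dsum_eq => n /=; rewrite -[f n]repK gr_map_cls ?rep_fil //.
    rewrite gr_map_cls ?scf_fil ?rep_fil //.
    suff -> : v (u (rep (f n))) = 1%g by exact: cls1.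
    have : range u (u (rep (f n))) by exists (rep (f n)).
    by rewrite ukerv.
  have [||f uf] := dsum_lift (gr G) (gr H) (@gr_map G H u) g.
  + exact: gr_map0.
  + move=> n; apply: (gr_map_exact _ _ _ _ v); rewrite ?uG ?vH //.
    exact: (congr1 (fun h : Lie K => h n) vg0).
  by exists f => //; exact: dsum_eq.
- apply/seteqP; split=> // g _.
  have [||f vf] := dsum_lift (gr H) (gr K) (@gr_map H K v) g.
  + exact: gr_map0.
  + by move=> n; apply: gr_map_surj; exact: vH.
  by exists f => //; exact: dsum_eq.
Qed.
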